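(* Consider the $k$-agent competitive secretary game with deferred selections and random tie-breaking with $n\ge k$ awards (defined in the context), and let $y_i$ denote the $i$-th largest award value. Let $S=(\sigma_1,\dots,\sigma_k)$ be the profile in which every agent $i$ plays the strategy $\sigma_i$ defined in the context. Then the expected sum of the awards allocated under $S$ is at least $\frac{k-1}{k}\sum_{i=1}^k y_i$.
   Context: Game: there are $n$ non-negative real awards, unknown in advance, revealed one per time step in a uniformly random order; $v_t$ is the award revealed at time $t$. There are $k$ agents. Upon the revelation of $v_t$, every agent that has not yet received an award (an active agent) may select one of the awards among $v_1,\dots,v_t$ that have not yet been assigned (available awards), or pass. An award selected by a single agent is assigned to that agent; an award selected by several agents is assigned to one of them chosen uniformly at random. Agents that received an award become inactive and assigned awards become unavailable. If after time $n$ active agents remain, they continue competing (with no new arrivals) over the remaining available awards until all agents are allocated. Strategy $\sigma_i$: let $\ell_t$ be the number of active agents at time $t$ (including $i$). If $t\ge n$, select the maximal available award. If $n/\ell_t<t<n$ and the maximal award among $v_1,\dots,v_t$ is available, select it. If $t=n/2$, $\ell_t=2$ and the maximal award so far is available, select it. Otherwise pass. *)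

(* Defs.v *)
From HB Require Import structures.
From mathcomp Require Import all_boot all_order all_algebra all_fingroup.
Set Implicit Arguments. Unset Strict Implicit. Unset Printing Implicit Defensive.
Import Order.TTheory GRing.Theory Num.Theory.
Local Open Scope ring_scope.

(* k-agent competitive secretary game with deferred selections and random
   tie-breaking.  Awards are labelled by 'I_n, with values v : 'I_n -> R.
   The random arrival order is a permutation pi : 'S_n ; at (1-indexed)
   time t <= n the award with label pi (t-1) is revealed, i.e. the award a
   is revealed at time (pi^-1 a) + 1. *)

Section Game.
Variables (R : realFieldType) (n k : nat).
Variables (v : 'I_n -> R) (pi : 'S_n).

Definition arrival (a : 'I_n) : nat := (pi^-1)%g a.

Definition revealed (t : nat) : {set 'I_n} := [set a | arrival a < t]%N.

Definition best (S : {set 'I_n}) : option 'I_n :=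
  [pick a in S | [forall b in S,
     (v b < v a) || ((v b == v a) && (arrival a <= arrival b)%N)]].

(* A strategy maps (time t, number l of active agents, set of available
   awards, set of revealed awards) to a selection (Some a) or a pass (None). *)
Definition strategy := nat -> nat -> {set 'I_n} -> {set 'I_n} -> option 'I_n.

Definition sigma : strategy := fun t l avail rev =>
  if (n <= t)%N then best avail
  else match best rev with
       | Some m =>
           if ((n < t * l)%N || ((t.*2 == n) && (l == 2%N))) && (m \in avail)
           then Some m else None
       | None => None
       end.

Variable prof : 'I_k -> strategy.

(* expected total value allocated from state (time t about to happen,
   active agents A, already-assigned awards C), with at most [fuel] steps *)
Fixpoint play (fuel t : nat) (A : {set 'I_k}) (C : {set 'I_n}) : R :=
  match fuel with
  | 0%N => 0
  | fuel'.+1 =>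
    if A == set0 then 0 else
    let rev := revealed t in
    let avail := rev :\: C in
    let sel (i : 'I_k) : option 'I_n :=
      if i \in A then
        match prof i t #|A| avail rev with
        | Some a => if a \in avail then Some a else None
        | None => None
        end
      else None in
    let Sel := [set a | [exists i, sel i == Some a]] in
    (* tie-breaking outcomes: for each selected award, the winning agent,
       drawn uniformly and independently among its selectors *)
    let W := [set w : {ffun 'I_n -> option 'I_k} |
               [forall a, if a \in Sel then
                            (if w a is Some i then sel i == Some a else false)
                          else w a == None]] in
    let winners (w : {ffun 'I_n -> option 'I_k}) :=
      [set i | [exists a, w a == Some i]] in
    (#|W|%:R)^-1 *
      \sum_(w in W) (\sum_(a in Sel) v a + play fuel' t.+1 (A :\: winners w) (C :|: Sel))
  end.

End Game.

(* Expected sum of allocated awards under the profile prof, averaging over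
   the uniformly random arrival order.  The game starts at time 1 with all
   agents active and nothing assigned; n + k steps always suffice for the
   game to end when each step after time n allocates an award. *)
Definition expected_total (R : realFieldType) (n k : nat) (v : 'I_n -> R)
  (prof : 'S_n -> 'I_k -> strategy n) : R :=
  (n`!%:R)^-1 * \sum_(pi : 'S_n) play v pi (prof pi) (n + k) 1 [set: 'I_k] set0.

Definition sorted_desc (R : realFieldType) (n : nat) (v : 'I_n -> R) : seq R :=
  sort (fun x y => y <= x) [seq v a | a <- enum 'I_n].

Definition top_sum (R : realFieldType) (n : nat) (v : 'I_n -> R) (k : nat) : R :=
  \sum_(i < k) nth 0 (sorted_desc v) i.

(* Main.v *)
(* Write y_1 >= y_2 >= ... for the sorted awards, T_j for the set of the top j
   awards (ties broken by a fixed ranking), and Z_j for the number of selections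
   made before any award of T_j is revealed.  A selection made later than that
   but before time n takes an award of value at least y_j, and from time n on the
   best available awards are taken, so at least j - N_j allocated awards have
   value at least y_j, where N_j = max(0, Z_j - (k - j)).  By Abel summation it
   suffices to show E[N_j] <= j/k.

   - E[Z_k] <= 1.  A selection takes place at a time t with t >= n/k, and takes
     either the maximum at the first such time or an award arriving later as a
     strict maximum so far, which has conditional probability at most
     1/t <= k/n.  So E[Z_k] is at most k/n times the expected number of awards
     revealed before T_k, which is (n - k)/(k + 1).
   - (j + 1) E[N_j] <= j E[N_{j+1}].  We have N_j <= N_{j+1} - 1 when N_{j+1} > 0,
     unless y_{j+1} is the first award of T_{j+1} to be revealed.  The latter has
     probability 1/(j + 1) independently of N_{j+1}, and N_{j+1} <= j because the
     last agent waits until time n. *)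

Require Import Defs.
From HB Require Import structures.
From mathcomp Require Import all_boot all_order all_algebra all_fingroup.
From mathcomp Require Import zify ring.
Set Implicit Arguments. Unset Strict Implicit. Unset Printing Implicit Defensive.
Import Order.TTheory GRing.Theory Num.Theory.
Local Open Scope ring_scope.

(** * Arrival orders, running maxima and the first arrival from a set *)

Section Orders.
Variables (R : realFieldType) (n : nat) (v : 'I_n -> R).
Implicit Types (pi : 'S_n) (S T : {set 'I_n}).

Lemma arrivalK pi (p : 'I_n) : arrival pi (pi p) = p.
Proof. by rewrite /arrival permK. Qed.

Lemma arrival_inj pi : injective (arrival pi).
Proof. by move=> a b /ord_inj /perm_inj. Qed.

Lemma ltn_arrival pi a : (arrival pi a < n)%N.
Proof. exact: ltn_ord. Qed.

Lemma bestP pi S m : best v pi S = Some m ->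
  m \in S /\ (forall b, b \in S ->
     (v b < v m) || ((v b == v m) && (arrival pi m <= arrival pi b)%N)).
Proof.
rewrite /best; case: pickP => [a /andP[aS /forallP aP] [<-]|//].
by split=> // b bS; have /implyP/(_ bS) := aP b.
Qed.

Lemma best_ge pi S m b : best v pi S = Some m -> b \in S -> v b <= v m.
Proof.
by move=> /bestP[_ mP] /mP /orP[/ltW //|/andP[/eqP->]].
Qed.

Lemma best_uniq pi S m : m \in S -> (forall b, b \in S ->
     (v b < v m) || ((v b == v m) && (arrival pi m <= arrival pi b)%N)) ->
  best v pi S = Some m.
Proof.
move=> mS mP; case E: (best v pi S) => [a|]; last first.
  move: E; rewrite /best; case: pickP => // /(_ m) /negbT /negP[]; apply/andP; split=> //.
  by apply/forallP => b; apply/implyP; exact: mP.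
have [aS aP] := bestP E; congr Some; apply: (@arrival_inj pi).
have := mP _ aS; have := aP _ mS.
case: ltgtP => //= _ h1 h2.
by apply/eqP; rewrite eqn_leq h1 h2.
Qed.

Lemma best_nonempty pi S a : a \in S -> exists m, best v pi S = Some m.
Proof.
move=> aS; case: (@arg_maxP _ _ _ a (fun b => b \in S) v aS) => m0 m0S m0P.
have m0S' : m0 \in [set b in S | v b == v m0] by rewrite inE m0S eqxx.
case: (@arg_minnP _ m0 (fun b => b \in [set b in S | v b == v m0]) (arrival pi) m0S') => m.
rewrite inE => /andP[mS /eqP vm] mP; exists m; apply: best_uniq => // b bS.
have : v b <= v m0 := m0P b bS; rewrite vm le_eqVlt => /orP[/eqP vb|->] //.
by rewrite vb eqxx mP ?orbT // inE bS vb eqxx.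
Qed.

Lemma best_ext pi pi' S : {in S, arrival pi =1 arrival pi'} ->
  best v pi S = best v pi' S.
Proof.
move=> E; rewrite /best; apply: eq_pick => a /=.
apply: andb_id2l => aS; apply: eq_forallb => b.
by case bS: (b \in S) => //=; rewrite !E.
Qed.

Definition same_start pi pi' (u : nat) := forall p : 'I_n, (p < u)%N -> pi p = pi' p.

Lemma same_start_arrival pi pi' u a : same_start pi pi' u ->
  (arrival pi a < u)%N -> arrival pi' a = arrival pi a.
Proof.
by move=> E lta; rewrite -{1}[a](permKV pi) E // arrivalK.
Qed.

Lemma same_start_sym pi pi' u : same_start pi pi' u -> same_start pi' pi u.
Proof. by move=> E p /E ->. Qed.

Lemma revealed_ext pi pi' t : same_start pi pi' t -> revealed pi t = revealed pi' t.
Proof.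
move=> E; apply/setP=> a; rewrite !inE.
apply/idP/idP => h; first by rewrite (same_start_arrival E h).
by rewrite (same_start_arrival (same_start_sym E) h).
Qed.

(** Zero-based position of the first arrival from [T], revealed at time [(delay pi T).+1]; the value
    is [n] when [T] is empty. *)
Definition delay pi T : nat := find (fun p => pi p \in T) (enum 'I_n).

Lemma leq_delay pi T a : a \in T -> (delay pi T <= arrival pi a)%N.
Proof.
move=> aT; rewrite leqNgt; apply/negP => lt.
have := @before_find _ ((pi^-1)%g a) (fun p => pi p \in T) (enum 'I_n) _ lt.
by rewrite nth_ord_enum permKV aT.
Qed.

Lemma delayP pi T (u : nat) : (u <= n)%N ->
  reflect (forall a, a \in T -> (u <= arrival pi a)%N) (u <= delay pi T)%N.
Proof.
move=> un; apply: (iffP idP) => [ud a /(leq_delay pi)|h]; first exact: leq_trans.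
rewrite leqNgt; apply/negP => ltd; have dn := leq_trans ltd un.
have hs : has (fun p => pi p \in T) (enum 'I_n) by rewrite has_find size_enum_ord.
have := nth_find (Ordinal dn) hs; rewrite (nth_ord_enum _ (Ordinal dn)).
by move=> /h; rewrite arrivalK leqNgt ltd.
Qed.

Lemma delay_attained pi T a : a \in T ->
  exists2 b, b \in T & arrival pi b = delay pi T.
Proof.
move=> aT; have dn : (delay pi T < n)%N := leq_ltn_trans (leq_delay pi aT) (ltn_arrival _ _).
have hs : has (fun p => pi p \in T) (enum 'I_n) by rewrite has_find size_enum_ord.
exists (pi (Ordinal dn)); last by rewrite arrivalK.
have := nth_find (Ordinal dn) hs.
by rewrite -/(delay pi T) (nth_ord_enum (Ordinal dn) (Ordinal dn)).
Qed.

Lemma ltn_delay pi T a : a \in T -> (delay pi T < n)%N.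
Proof. by move=> /(leq_delay pi) h; exact: leq_ltn_trans h (ltn_arrival _ _). Qed.

Lemma arrival_tperm pi x y a :
  arrival (pi * tperm x y)%g a = arrival pi (tperm x y a).
Proof. by rewrite /arrival invMg tpermV permM. Qed.

Lemma delay_tperm pi T x y : x \in T -> y \in T ->
  delay (pi * tperm x y)%g T = delay pi T.
Proof.
move=> xT yT; apply: eq_find => p /=; rewrite permM.
by case: tpermP => [->|->|//]; rewrite xT yT.
Qed.

Lemma same_start_tperm pi T x y : x \in T -> y \in T ->
  same_start pi (pi * tperm x y)%g (delay pi T).
Proof.
move=> xT yT p lp; rewrite permM.
have pT : pi p \notin T.
  by apply/negP => /(leq_delay pi); rewrite arrivalK leqNgt lp.
by rewrite tpermD //; apply: contraNneq pT => <-.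
Qed.

(* Transposing labels inside [T] makes every element of [T] equally likely to
   be the first one revealed. *)
Lemma first_uniform (f : 'S_n -> nat) T z : z \in T ->
  (forall pi x y, x \in T -> y \in T -> f (pi * tperm x y)%g = f pi) ->
  (#|T| * (\sum_pi f pi * (arrival pi z == delay pi T)) = \sum_pi f pi)%N.
Proof.
move=> zT fT.
have -> : (\sum_pi f pi = \sum_(b in T) \sum_pi f pi * (arrival pi b == delay pi T))%N.
  rewrite exchange_big /=; apply: eq_bigr => pi _.
  have [b bT bd] := delay_attained pi zT.
  rewrite (bigD1 b) //= bd eqxx muln1 big1 ?addn0 // => c /andP[cT cb].
  case: eqP => [cd|]; last by rewrite muln0.
  by case/eqP: cb; apply: (@arrival_inj pi); rewrite cd.
rewrite -sum_nat_const; apply: eq_bigr => b bT.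
rewrite (reindex_inj (mulIg (tperm z b))) /=; apply: eq_bigr => pi _.
by rewrite fT // arrival_tperm tpermL delay_tperm.
Qed.

(** The delay counts the labels [b] outside [T] that precede all of [T]. Each does so with
    probability [1/(#|T| + 1)], weakened here to [1/#|T|], and there are at most [n] of them. *)
Lemma sum_delay T a : a \in T ->
  (#|T| * (\sum_pi delay pi T) <= n * n`!)%N.
Proof.
move=> aT.
have E pi : delay pi T = (\sum_(b | b \notin T) (arrival pi b == delay pi (b |: T)))%N.
  transitivity #|revealed pi (delay pi T)|.
    rewrite -sum1_card (reindex_inj (@perm_inj _ pi)) /=.
    under eq_bigl => p do rewrite inE arrivalK.
    have dn := ltnW (ltn_delay pi aT).
    by rewrite (big_ord_narrow dn) sum1_card card_ord.
  rewrite -sum1_card big_mkcond [RHS]big_mkcond /=; apply: eq_bigr => b _.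
  rewrite inE; case: ifP => [lt|/negbT]; last rewrite -leqNgt => le.
    have bT : b \notin T by apply/negP => /(leq_delay pi); rewrite leqNgt lt.
    rewrite bT; suff -> : arrival pi b = delay pi (b |: T) by rewrite eqxx.
    apply/eqP; rewrite eqn_leq (leq_delay pi) ?setU11 // andbT.
    apply/delayP; first exact: ltnW (ltn_arrival _ _).
    move=> c; rewrite in_setU1 => /predU1P[->//|cT].
    exact: leq_trans (ltnW lt) (leq_delay pi cT).
  case: ifP => // bT; case: eqP => // bd.
  have [c cT cd] := delay_attained pi aT.
  have : (delay pi (b |: T) <= arrival pi c)%N by apply: leq_delay; rewrite in_setU1 cT orbT.
  rewrite -bd cd => h; have cb : arrival pi c = arrival pi b by apply/eqP; rewrite cd eqn_leq le h.
  by move: bT; rewrite -(arrival_inj cb) cT.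
under eq_bigr => pi _ do rewrite E.
rewrite exchange_big big_distrr /=.
apply: (@leq_trans (\sum_(b | b \notin T) n`!)%N); last first.
  rewrite sum_nat_const leq_mul2r; apply/orP; right.
  by have := max_card (fun b => b \notin T); rewrite card_ord.
apply: leq_sum => b bT.
have := @first_uniform (fun=> 1%N) (b |: T) b (setU11 _ _) (fun _ _ _ _ _ => erefl).
rewrite sum1_card card_Sn cardsU1 bT.
under eq_bigr => pi _ do rewrite mul1n.
by move=> <-; rewrite leq_mul2r leqnSn orbT.
Qed.

End Orders.

(** * The deterministic course of play *)

Section Dynamics.
Variables (R : realFieldType) (n k : nat) (v : 'I_n -> R).
Implicit Types (pi : 'S_n) (C S T : {set 'I_n}).

(* All active agents make the same choice, so the set of assigned awards
   evolves deterministically and every tie has exactly one winner. *)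
Definition choice pi t C : option 'I_n :=
  if (#|C| < k)%N then
    sigma v pi t (k - #|C|)%N (revealed pi t :\: C) (revealed pi t)
  else None.

Definition step pi t C : {set 'I_n} :=
  if choice pi t C is Some a then a |: C else C.

(** State just before the selection at time [t]. The recursion starts one step before the game, at
    time [0], when nothing is revealed and so nothing is taken. *)
Fixpoint assigned pi t : {set 'I_n} :=
  if t is t'.+1 then step pi t' (assigned pi t') else set0.

Lemma sigma_avail pi t l S T a : sigma v pi t l S T = Some a -> a \in S.
Proof.
rewrite /sigma; case: ifP => _; first by case/bestP.
by case: (best v pi T) => // m; case: ifP => // /andP[_ mS] [<-].
Qed.

Lemma choice_avail pi t C a : choice pi t C = Some a -> a \notin C.
Proof. by rewrite /choice; case: ifP => // _ /sigma_avail; rewrite inE => /andP[]. Qed.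

Lemma choice_lt pi t C a : choice pi t C = Some a -> (#|C| < k)%N.
Proof. by rewrite /choice; case: ifP. Qed.

(** Both early rules give [n <= t * l] with [l <= k] active agents. A lone agent would need [n < t],
    so the last agent waits until time [n]. *)
Lemma choice_early pi t C a : (t < n)%N -> choice pi t C = Some a ->
  [/\ best v pi (revealed pi t) = Some a, (n <= t * k)%N & (#|C|.+1 < k)%N].
Proof.
move=> tn; rewrite /choice /sigma [(n <= t)%N]leqNgt tn /=; case: ifP => // Ck.
case: best => // m; case: ifP => // /andP[h _] [<-]; split=> //.
  have : (t * (k - #|C|) <= t * k)%N by rewrite leq_mul2l leq_subr orbT.
  by case/orP: h => [|/andP[/eqP nt /eqP ->]]; lia.
by case/orP: h => [|/andP[_ /eqP]]; nia.
Qed.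

Lemma choice_late pi t C : (n <= t)%N -> (k <= n)%N -> (#|C| < k)%N ->
  exists a, best v pi (~: C) = Some a /\ choice pi t C = Some a.
Proof.
move=> nt kn Ck.
have revT : revealed pi t = setT.
  by apply/setP=> a; rewrite !inE (leq_trans (ltn_arrival pi a)).
rewrite /choice Ck /sigma nt revT setTD.
have /card_gt0P[a aC] : (0 < #|~: C|)%N.
  by have := cardsC C; rewrite card_ord; lia.
by have [m E] := best_nonempty v pi aC; exists m.
Qed.

Lemma step_sub pi t C : C \subset step pi t C.
Proof. by rewrite /step; case: choice => // a; exact: subsetUr. Qed.

Lemma assigned_early pi t : (0 < k)%N -> (t <= n)%N -> (#|assigned pi t| < k)%N.
Proof.
move=> k0; elim: t => [|t IH] tn; first by rewrite cards0.
rewrite /= /step; case E: choice => [a|]; last exact: IH (ltnW tn).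
by rewrite cardsU1 (choice_avail E); have [_ _] := choice_early tn E.
Qed.

Lemma assigned_late pi i : (k <= n)%N -> (minn k i <= #|assigned pi (n + i)|)%N.
Proof.
move=> kn; elim: i => [|i IH]; first by rewrite minn0.
rewrite addnS /= /step; case: (ltnP #|assigned pi (n + i)| k) => [lt|ge].
  have [a [_ E]] := choice_late pi (leq_addr i n) kn lt.
  by rewrite E cardsU1 (choice_avail E); lia.
rewrite geq_min (leq_trans ge) //.
by case: choice => // a; rewrite subset_leq_card // subsetUr.
Qed.

Lemma assigned_le pi t : (#|assigned pi t| <= k)%N.
Proof.
elim: t => [|t IH] /=; first by rewrite cards0.
rewrite /step; case E: choice => [a|] //.
by rewrite cardsU1 (choice_avail E); exact: choice_lt E.
Qed.

Lemma assigned_full pi : (k <= n)%N -> #|assigned pi (n + k).+1| = k.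
Proof.
move=> kn; apply/eqP; rewrite eqn_leq assigned_le /=.
apply: leq_trans (subset_leq_card (step_sub _ _ _)).
by have := assigned_late pi k kn; rewrite minnn.
Qed.

Lemma sum_constant (I : finType) (W : {set I}) (F : I -> R) x w0 :
  w0 \in W -> (forall w, w \in W -> F w = x) ->
  (#|W|%:R)^-1 * \sum_(w in W) F w = x.
Proof.
move=> w0W FW; rewrite (eq_bigr (fun=> x)) // sumr_const -[x *+ _]mulr_natl mulKf //.
by rewrite pnatr_eq0 -lt0n; apply/card_gt0P; exists w0.
Qed.

Lemma play_pass pi fuel t (A : {set 'I_k}) C : A != set0 ->
  sigma v pi t #|A| (revealed pi t :\: C) (revealed pi t) = None ->
  play v pi (fun=> sigma v pi) fuel.+1 t A C
    = play v pi (fun=> sigma v pi) fuel t.+1 A C.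
Proof.
move=> /negbTE A0 E; rewrite /= A0 E.
have -> : [set a : 'I_n | [exists i : 'I_k, (if i \in A then None else None) == Some a]] = set0.
  by apply/setP=> a; rewrite !inE; apply/existsP => -[i]; rewrite if_same.
apply: (@sum_constant _ _ _ _ [ffun=> None]) => [|w].
  by rewrite inE; apply/forallP => a; rewrite inE ffunE.
rewrite inE => /forallP wP; rewrite big_set0 add0r setU0.
have -> : [set i | [exists a, w a == Some i]] = set0; last by rewrite setD0.
apply/setP=> i; rewrite !inE; apply/existsP => -[a].
by have := wP a; rewrite inE => /eqP ->.
Qed.

(** Tie-breaking only decides which active agent wins [a]. The continuation is assumed to have the
    same value for all survivor sets of the resulting size, so averaging over winners leaves [x]. *)
Lemma play_select pi fuel t (A : {set 'I_k}) C a x : A != set0 ->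
  sigma v pi t #|A| (revealed pi t :\: C) (revealed pi t) = Some a ->
  (forall A' : {set 'I_k}, #|A'| = #|A|.-1 ->
     v a + play v pi (fun=> sigma v pi) fuel t.+1 A' (a |: C) = x) ->
  play v pi (fun=> sigma v pi) fuel.+1 t A C = x.
Proof.
move=> A0 E xP; rewrite /= (negbTE A0) E (sigma_avail E).
have [i0 i0A] := set0Pn _ A0.
have -> : [set b | [exists i, (if i \in A then Some a else None) == Some b]] = [set a].
  apply/setP=> b; rewrite !inE; apply/existsP/eqP => [[i]|->].
    by case: ifP => // _ /eqP[].
  by exists i0; rewrite i0A.
apply: (@sum_constant _ _ _ _ [ffun b => if b == a then Some i0 else None]) => [|w].
  rewrite inE; apply/forallP => b; rewrite inE ffunE.
  by case: eqP => [->|//]; rewrite i0A.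
rewrite inE => /forallP wP; rewrite big_set1 setUC.
have [i iA wa] : exists2 i, i \in A & w a = Some i.
  have := wP a; rewrite set11; case: (w a) => // i.
  by case: ifP => // iA _; exists i.
have -> : [set j | [exists b, w b == Some j]] = [set i].
  apply/setP=> j; rewrite !inE; apply/existsP/eqP => [[b]|->]; last by exists a; rewrite wa.
  have := wP b; rewrite inE; case: eqP => [-> _|_ /eqP -> //].
  by rewrite wa => /eqP[].
by apply: xP; rewrite (cardsD1 i A) iA.
Qed.

(** Identities of agents never matter: induction on [fuel] needs only the number of active agents,
    so expected play reduces to the evolution of [assigned]. *)
Lemma play_assigned pi fuel t (A : {set 'I_k}) :
  #|A| = (k - #|assigned pi t|)%N ->
  \sum_(a in assigned pi t) v a
    + play v pi (fun=> sigma v pi) fuel t A (assigned pi t)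
  = \sum_(a in assigned pi (t + fuel)) v a.
Proof.
elim: fuel t A => [|fuel IH] t A cA; first by rewrite addr0 addn0.
have := IH t.+1; rewrite -addSnnS.
have -> : assigned pi t.+1 = step pi t (assigned pi t) by [].
rewrite /step /choice; move: cA; set C := assigned pi t => cA.
have [A0|A0] := eqVneq A set0.
  move: cA; rewrite A0 cards0 => /esym/eqP; rewrite subn_eq0 => kC.
  rewrite ltnNge kC /= eqxx => /(_ set0) <-; last by apply/esym/eqP; rewrite cards0 subn_eq0.
  by case: (fuel) => [|f] //=; rewrite eqxx.
have cA0 : (0 < #|A|)%N by rewrite card_gt0.
have -> : (#|C| < k)%N by lia.
rewrite -cA; case E: sigma => [a|]; last first.
  by move=> IH'; rewrite play_pass // IH'.
have aC : a \notin C by have := sigma_avail E; rewrite inE => /andP[].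
rewrite big_setU1 // => IH'.
rewrite (play_select A0 E (x := (\sum_(b in assigned pi (t.+1 + fuel)) v b) - \sum_(b in C) v b)).
  by rewrite addrC subrK.
by move=> A' cA'; rewrite -(IH' A') ?cardsU1 ?aC /=; [ring|rewrite cA' cA add1n subnS].
Qed.
End Dynamics.

(** * Selections made before the top awards arrive *)

Section Counting.
Variables (R : realFieldType) (n k : nat) (v : 'I_n -> R).
Hypotheses (k0 : (0 < k)%N) (kn : (k <= n)%N).
Implicit Types (pi : 'S_n) (C S T : {set 'I_n}).
Local Notation assigned := (assigned k v).
Local Notation choice := (choice k v).
Local Notation step := (step k v).

(** With [T] the top [j] awards this is Z_j, and [excess] is N_j, where truncated subtraction
    supplies the maximum with [0]. The successor index includes the selection at time [delay pi T],
    when [T] is still unseen. *)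
Definition taken_before pi T := #|assigned pi (delay pi T).+1|.
Definition excess pi T := (taken_before pi T - (k - #|T|))%N.

Definition above x : {set 'I_n} := [set a | x <= v a].

Lemma setDU1 (T U : {set 'I_n}) a : a \in U -> (a |: T) :\: U = T :\: U.
Proof.
move=> aU; apply/setP=> b; rewrite !inE.
by have [->|] := eqVneq b a; rewrite ?aU.
Qed.

(** Once an award of [T] is revealed, every selection before time [n] takes a running maximum, worth
    at least [x]; cheaper assigned awards were taken earlier. *)
Lemma taken_above pi T x : T != set0 -> (forall a, a \in T -> (x <= v a)%R) ->
  forall t, (delay pi T < t)%N -> (t <= n)%N ->
  assigned pi t :\: above x \subset assigned pi (delay pi T).+1.
Proof.
move=> /set0Pn[z zT] xT; have [c cT cd] := delay_attained pi zT.
elim=> // t IH; rewrite ltnS leq_eqVlt => /predU1P[<- _|dt tn].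
  exact: subsetDl.
rewrite /= /step; case E: choice => [a|]; last exact: IH (ltnW tn).
have [Eb _ _] := choice_early tn E.
rewrite setDU1 ?IH ?(ltnW tn) // inE (le_trans (xT _ cT)) //.
by apply: best_ge Eb _; rewrite inE cd.
Qed.

(** Induction on the steps from time [n] on. A selection worth at least [x] raises the right side by
    one and the left by at most one. Any other selection means that no award worth [x] is left, so
    all of [T] is assigned. *)
Lemma taken_late pi T x t : T != set0 -> (forall a, a \in T -> (x <= v a)%R) ->
  (n <= t)%N ->
  (minn #|T| (#|assigned pi t| - taken_before pi T)
     <= #|assigned pi t :&: above x|)%N.
Proof.
move=> T0 xT /subnKC <-; set U := above x.
have TU : T \subset U by apply/subsetP => a /xT; rewrite inE.
elim: (t - n)%N => [|i IH].
  rewrite addn0 geq_min; apply/orP; right.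
  have [z zT] := set0Pn _ T0.
  have := subset_leq_card (taken_above T0 xT (ltn_delay pi zT) (leqnn n)).
  by rewrite -(cardsID U (assigned pi n)) leq_subLR addnC leq_add2r.
rewrite addnS /= /step; case E: choice => [a|//].
have [m [Em Em']] := choice_late v pi (leq_addr i n) kn (choice_lt E).
move: Em'; rewrite E => -[am]; rewrite -am in Em.
have aC := choice_avail E.
rewrite cardsU1 aC setIUl; have [aU|aU] := boolP (a \in U).
  have -> : [set a] :&: U = [set a] by apply/setIidPl; rewrite sub1set.
  have incr (J c z y : nat) : (minn J (c - z) <= y -> minn J (1 + c - z) <= 1 + y)%N by lia.
  by rewrite cardsU1 in_setI (negbTE aC); apply: incr IH.
have UC : U \subset assigned pi (n + i).
  apply/subsetP => b bU; apply: contraNT aU => bC.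
  move: bU; rewrite !inE => /le_trans -> //.
  by apply: best_ge Em _; rewrite inE.
rewrite geq_min (leq_trans (subset_leq_card TU)) //.
by apply/subset_leq_card/(subset_trans _ (subsetUr _ _)); rewrite subsetI UC subxx.
Qed.

Lemma final_above pi T x : T != set0 -> (#|T| <= k)%N ->
  (forall a, a \in T -> (x <= v a)%R) ->
  (#|T| - excess pi T <= #|assigned pi (n + k).+1 :&: above x|)%N.
Proof.
move=> T0 Tk xT; apply: leq_trans (taken_late pi T0 xT _); last lia.
by rewrite assigned_full // /excess; lia.
Qed.

(** * Comparison of consecutive top sets *)

Lemma assigned_ext pi pi' u t : same_start pi pi' u -> (t <= u.+1)%N ->
  assigned pi t = assigned pi' t.
Proof.
move=> E; elim: t => // t IH tu; rewrite /= -IH ?(ltnW tu) // /step.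
suff -> : choice pi t (assigned pi t) = choice pi' t (assigned pi t) by [].
rewrite /choice; case: ifP => // _.
have Er : revealed pi t = revealed pi' t.
  by apply: revealed_ext => p pt; apply: E; exact: leq_trans pt tu.
have Ea : {in revealed pi t, arrival pi =1 arrival pi'}.
  by move=> a; rewrite inE => lt; rewrite (same_start_arrival E) // (leq_trans lt).
rewrite /sigma -Er (best_ext v Ea); case: ifP => // _; apply: best_ext.
by apply: sub_in1 Ea => a; rewrite inE => /andP[].
Qed.

(** The count depends only on the positions before the first arrival from [T], which a swap of two
    labels of [T] leaves alone. *)
Lemma taken_before_tperm pi T x y : x \in T -> y \in T ->
  taken_before (pi * tperm x y)%g T = taken_before pi T.
Proof.
move=> xT yT; rewrite /taken_before delay_tperm //.
by rewrite -(assigned_ext (same_start_tperm xT yT)).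
Qed.

Lemma best_stable pi t u m : best v pi (revealed pi t) = Some m -> (t <= u)%N ->
  (forall b, b \in revealed pi u -> b \notin revealed pi t -> v b <= v m) ->
  best v pi (revealed pi u) = Some m.
Proof.
move=> /bestP[mt mP] tu uP; move: (mt); rewrite inE => lmt.
apply: best_uniq => [|b bu]; first by rewrite inE (leq_trans lmt).
have [/mP //|bt] := boolP (b \in revealed pi t).
have -> : (arrival pi m <= arrival pi b)%N.
  by move: bt; rewrite inE -leqNgt; apply: leq_trans; exact: ltnW.
by move: (uP _ bu bt); rewrite le_eqVlt => /orP[->|->] //; rewrite orbT.
Qed.

Definition is_top T := forall a b, a \in T -> b \notin T -> v b <= v a.

(* From the arrival of [z] until that of an element of [T] the maximum so far
   does not change, hence at most one award is taken in between. *)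
Lemma taken_before_setU1 pi T z : T != set0 -> is_top T -> is_top (z |: T) ->
  (taken_before pi T <= taken_before pi (z |: T)
      + (arrival pi z == delay pi (z |: T)))%N.
Proof.
move=> /set0Pn[c cT] topT topzT; have dn := ltn_delay pi cT.
have zzT : z \in z |: T := setU11 _ _.
have [b bzT bd] := delay_attained pi zzT.
case: eqP => [zd|zd]; last first.
  suff -> : taken_before pi T = taken_before pi (z |: T) by rewrite leq_addr.
  suff dd : delay pi T = delay pi (z |: T) by rewrite /taken_before dd.
  apply/eqP; rewrite eqn_leq; apply/andP; split.
    move: bzT; rewrite in_setU1 => /predU1P[bz|bT]; first by case: zd; rewrite -bd bz.
    by rewrite -bd leq_delay.
  have [e eT <-] := delay_attained pi cT.
  by apply: leq_delay; rewrite in_setU1 eT orbT.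
set d' := delay pi (z |: T) in bd zd *.
have zr : z \in revealed pi d'.+1 by rewrite inE zd.
have [m Em] := best_nonempty v pi zr.
have stay u : (d' < u)%N -> (u <= delay pi T)%N ->
    best v pi (revealed pi u) = Some m.
  move=> du ud; apply: (best_stable Em du) => e eu et.
  apply: le_trans (best_ge Em zr); apply: topzT => //; rewrite in_setU1.
  apply/norP; split; first by apply: contraNneq et => ->.
  apply/negP => /(leq_delay pi); move: eu; rewrite inE => eu.
  by rewrite leqNgt (leq_trans eu).
have [e eT ed] := delay_attained pi cT.
have d'd : (d' <= delay pi T)%N by rewrite -ed leq_delay // in_setU1 eT orbT.
suff H i : (d' + i <= delay pi T)%N -> assigned pi (d' + i).+1 \subset m |: assigned pi d'.+1.
  have := H (delay pi T - d')%N; rewrite subnKC // => /(_ (leqnn _)) /subset_leq_card.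
  by rewrite cardsU1 /taken_before -/d'; case: (_ \notin _); lia.
elim: i => [|i IH] id; first by rewrite addn0 subsetUr.
rewrite addnS in id *.
rewrite [assigned pi _.+2]/= -/(assigned pi (d' + i).+1) /step.
case E: choice => [a|]; last exact: IH (ltnW id).
have [] := choice_early (leq_ltn_trans id dn) E.
rewrite stay //; last lia.
by move=> [<-] _ _; rewrite subUset sub1set setU11 IH // ltnW.
Qed.

(** Since the last agent waits until time [n], at most [k - 1] awards are taken before [T]
    appears. *)
Lemma excess_lt pi T : T != set0 -> (#|T| <= k)%N -> (excess pi T < #|T|)%N.
Proof.
move=> /set0Pn[z zT] Tk; have : (0 < #|T|)%N by apply/card_gt0P; exists z.
have := assigned_early v pi k0 (ltn_delay pi zT).
by rewrite /excess /taken_before; lia.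
Qed.

Lemma sum_excess_setU1 T z : T != set0 -> is_top T -> is_top (z |: T) ->
  z \notin T -> (#|T| < k)%N ->
  (#|T|.+1 * (\sum_pi excess pi T) <= #|T| * (\sum_pi excess pi (z |: T)))%N.
Proof.
move=> T0 topT topzT zT Tk.
have czT : #|z |: T| = #|T|.+1 by rewrite cardsU1 zT.
have zT0 : z |: T != set0 by apply/set0Pn; exists z; exact: setU11.
pose f pi : nat := (0 < excess pi (z |: T))%N.
pose first pi : nat := arrival pi z == delay pi (z |: T).
(* A positive excess drops by at least one from [z |: T] to [T], unless [z] arrives first. *)
have H1 : (\sum_pi excess pi T + \sum_pi f pi
    <= \sum_pi excess pi (z |: T) + \sum_pi f pi * first pi)%N.
  rewrite -!big_split; apply: leq_sum => pi _ /=.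
  have := taken_before_setU1 pi T0 topT topzT.
  by rewrite /f /first /excess czT; case: (_ == _); lia.
(* Swapping labels inside [z |: T] preserves [f], so [f] is independent of which of them arrives
   first. *)
have H2 : (#|T|.+1 * (\sum_pi f pi * first pi) = \sum_pi f pi)%N.
  rewrite -czT; apply: first_uniform => [|pi x y xT yT]; first exact: setU11.
  by rewrite /f /excess taken_before_tperm.
have H3 : (\sum_pi excess pi (z |: T) <= #|T| * \sum_pi f pi)%N.
  rewrite big_distrr; apply: leq_sum => pi _ /=.
  have := excess_lt pi zT0; rewrite czT => /(_ Tk); rewrite /f.
  by case: (excess pi (z |: T)) => //= e; lia.
(* After scaling, [H2] cancels one copy of the sum of [f]; by [H3] the other [#|T|] copies dominate
   the sum of excesses of [z |: T]. *)
have : (#|T|.+1 * (\sum_pi excess pi T + \sum_pi f pi)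
    <= #|T|.+1 * (\sum_pi excess pi (z |: T) + \sum_pi f pi * first pi))%N.
  by rewrite leq_mul2l H1.
by rewrite !mulnDr H2 !mulSn; lia.
Qed.

(* Every selection happens at a time [t] with [n <= t * k], that is
   [start <= t]. *)
Definition start := (n.-1 %/ k).+1.

Lemma start_le t : (start <= t)%N = (n <= t * k)%N.
Proof. by rewrite /start ltn_divLR // prednK // (leq_trans k0). Qed.

(** * Records and the selections before the top [k] awards *)

Definition record_at pi t (i : nat) : bool :=
  if best v pi (revealed pi t) is Some m then arrival pi m == i else false.

Lemma sum_record_at pi t : (\sum_(i < t) record_at pi t i <= 1)%N.
Proof.
rewrite /record_at; case: best => [m|]; last by rewrite big1.
have [lt|ge] := ltnP (arrival pi m) t.
  rewrite (bigD1 (Ordinal lt)) //= eqxx big1 // => i ne.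
  by apply/eqP; rewrite eqb0; apply: contraNneq ne => /esym E; apply/eqP/val_inj.
by rewrite big1 // => i _; apply/eqP; rewrite eqb0 gtn_eqF // (leq_trans _ ge).
Qed.

(** Multiplication on the left swaps two positions, whereas [arrival_tperm] swaps two labels. *)
Lemma arrival_mul_tperm pi (i j : 'I_n) a :
  arrival (tperm i j * pi)%g a = tperm i j ((pi^-1)%g a).
Proof. by rewrite /arrival invMg tpermV permM. Qed.

Lemma tperm_ltn (i j p : 'I_n) t : (i < t)%N -> (j < t)%N ->
  (tperm i j p < t)%N = (p < t)%N.
Proof. by case: tpermP => [->|->|//] -> ->. Qed.

Lemma revealed_tperm pi (i j : 'I_n) t : (i < t)%N -> (j < t)%N ->
  revealed (tperm i j * pi)%g t = revealed pi t.
Proof. by move=> it jt; apply/setP=> a; rewrite !inE arrival_mul_tperm tperm_ltn. Qed.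

Lemma delay_mul_tperm pi T (i j : 'I_n) t : (i < t)%N -> (j < t)%N -> (t <= n)%N ->
  (t <= delay (tperm i j * pi)%g T)%N = (t <= delay pi T)%N.
Proof.
move=> it jt tn; apply/delayP/delayP => // h a /h; rewrite arrival_mul_tperm;
  by apply: contraLR; rewrite -!ltnNge tperm_ltn.
Qed.

(* A maximum sitting at the last position beats all the others strictly, so it
   stays the maximum when moved to an earlier position. *)
Lemma record_move pi (i j : 'I_n) : (i <= j)%N ->
  record_at pi j.+1 j -> record_at (tperm i j * pi)%g j.+1 i.
Proof.
move=> ij; rewrite /record_at revealed_tperm //.
case E: (best v pi _) => [m|] // /eqP mj.
have [mr mP] := bestP E.
have mj' : (pi^-1)%g m = j by apply: val_inj.
rewrite (@best_uniq _ _ _ _ _ m) // => [|b br].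
  by rewrite arrival_mul_tperm mj' tpermR.
have [->|bm] := eqVneq b m; first by rewrite eqxx leqnn orbT.
have /orP[->//|/andP[_]] := mP b br.
rewrite mj => le; case/eqP: bm; apply: (@arrival_inj _ pi).
by apply/eqP; rewrite eqn_leq mj le andbT; move: br; rewrite inE.
Qed.

(** Position swaps carry a maximum at [j] to any [i <= j] and preserve the event [j < delay pi T].
    The [j + 1] resulting events are disjoint, so given that event a record has probability at most
    [1/(j + 1)]. *)
Lemma sum_record T (j : 'I_n) :
  (j.+1 * (\sum_(pi : 'S_n) ((j < delay pi T) && record_at pi j.+1 j))
     <= \sum_(pi : 'S_n) (j < delay pi T))%N.
Proof.
apply: (@leq_trans (\sum_(i < j.+1) \sum_(pi : 'S_n)
   ((j < delay pi T) && record_at pi j.+1 i))%N); last first.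
  rewrite exchange_big; apply: leq_sum => pi _ /=.
  case: (j < _)%N; last by rewrite big1.
  exact: sum_record_at.
rewrite -{1}(card_ord j.+1) -sum_nat_const; apply: leq_sum => i _.
have ijn : (i < n)%N := leq_ltn_trans (ltn_ord i : (i <= j)%N) (ltn_ord j).
pose i' := Ordinal ijn.
rewrite [X in (_ <= X)%N](reindex_inj (mulgI (tperm i' j))) /=; apply: leq_sum => pi _.
rewrite delay_mul_tperm // ?ltnS; last exact: (ltn_ord i : (i <= j)%N).
case: (j < _)%N => //=; case E: record_at => //.
by rewrite (record_move (_ : (i' <= j)%N) E) //; exact: (ltn_ord i : (i <= j)%N).
Qed.

Lemma assigned_start pi t : (t <= start)%N -> assigned pi t = set0.
Proof.
elim: t => // t IH ts; rewrite /= /step IH ?(ltnW ts) //.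
case E: choice => [a|//].
have n0 : (0 < n)%N := leq_trans k0 kn.
have tn : (t < n)%N by apply: leq_trans ts _; rewrite start_le leq_pmulr.
have [_] := choice_early tn E.
by rewrite -start_le leqNgt ts.
Qed.

Lemma best_record pi (j : 'I_n) : ~~ record_at pi j.+1 j ->
  best v pi (revealed pi j.+1) = best v pi (revealed pi j).
Proof.
rewrite /record_at; case E: (best v pi (revealed pi j.+1)) => [m|]; last first.
  have aj : pi j \in revealed pi j.+1 by rewrite inE arrivalK.
  by have [m Em] := best_nonempty v pi aj; rewrite Em in E.
move=> mj; have [mr mP] := bestP E; apply/esym/best_uniq => [|b br].
  by move: mr; rewrite !inE ltnS leq_eqVlt (negbTE mj).
by apply: mP; move: br; rewrite !inE => /ltnW.
Qed.

Definition best_taken pi t : bool :=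
  if best v pi (revealed pi t) is Some m then m \in assigned pi t.+1 else false.

(** Each selection takes the running maximum, and each maximum is taken at most once. The records
    since [start] pay for the earlier maxima, [best_taken] for the current one. *)
Lemma assigned_records pi t : (start <= t)%N -> (t < n)%N ->
  (#|assigned pi t.+1| <=
     \sum_(start <= u < t) record_at pi u.+1 u + best_taken pi t)%N.
Proof.
move=> st tn.
have taken u (C : nat) : (u < n)%N -> #|assigned pi u| = C ->
    (#|assigned pi u.+1| <= C + best_taken pi u)%N.
  move=> un <-; rewrite /best_taken /= /step.
  case E: choice => [a|]; last exact: leq_addr.
  have [-> _ _] := choice_early un E.
  by rewrite setU11 cardsU1 addnC leq_add2l leq_b1.
elim: t st tn => [|t IH] st tn; first by rewrite /start in st.
move: st; rewrite leq_eqVlt => /predU1P[ts|ts].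
  rewrite -ts big_geq // ts; apply: taken => //.
  by rewrite assigned_start ?cards0 // ts.
have {IH} := IH ts (ltnW tn); rewrite big_nat_recr //.
set s := (\sum_(_ <= _ < _) _)%N; move=> IH.
(* A record adds one to the sum, which absorbs the old [best_taken]. *)
have [r|r] := boolP (record_at pi t.+1 t).
  apply: leq_trans (taken _ _ tn erefl) _.
  by rewrite leq_add2r (leq_trans IH) // leq_add2l leq_b1.
(* Without a record the maximum is unchanged; if it is selected now, the old [best_taken] was
   false. *)
change (#|assigned pi t.+2| <= s + 0 + best_taken pi t.+1)%N.
rewrite addn0; move: IH; rewrite /best_taken (best_record (j := Ordinal (ltnW tn)) r).
rewrite -[assigned pi t.+2]/(step pi t.+1 (assigned pi t.+1)) /step.
case E: choice => [a|//].
have [] := choice_early tn E; rewrite (best_record (j := Ordinal (ltnW tn)) r) => -> _ _.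
rewrite setU11 cardsU1 (negbTE (choice_avail E)).
by move=> IH; rewrite (addnC s) leq_add2l -[s]addn0.
Qed.

(** The selections are compared term by term with [k/n] times the delay, itself bounded by
    [sum_delay]: the first selection uses the time units before [start], a record at position [u]
    uses the unit [u]. *)
Lemma sum_taken_before T : #|T| = k -> (\sum_pi taken_before pi T <= n`!)%N.
Proof.
move=> Tk; have n0 : (0 < n)%N := leq_trans k0 kn.
have [z zT] : exists z, z \in T by apply/card_gt0P; rewrite Tk.
pose e pi u : nat := (u < delay pi T)%N && record_at pi u.+1 u.
have startn : (start <= n)%N by rewrite start_le leq_pmulr.
have by_records pi : (taken_before pi T
    <= (start <= delay pi T) + \sum_(start <= u < n) e pi u)%N.
  rewrite /taken_before; have dn := ltn_delay pi zT.
  have [sd|ds] := leqP start (delay pi T); last by rewrite assigned_start ?cards0.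
  apply: leq_trans (assigned_records pi sd dn) _.
  rewrite addnC leq_add ?leq_b1 //.
  rewrite [leqRHS](big_cat_nat (n := delay pi T)) ?(ltnW dn) //=.
  apply: leq_trans (leq_addr _ _).
  rewrite big_nat [leqRHS]big_nat; apply: leq_sum => u /andP[_ ud].
  by rewrite /e ud.
have delayE pi : (delay pi T = \sum_(0 <= u < n) (u < delay pi T))%N.
  have dn := ltnW (ltn_delay pi zT).
  rewrite (big_cat_nat (n := delay pi T)) //= [X in (_ + X)%N](_ : _ = 0%N).
    rewrite addn0 big_nat (eq_bigr (fun=> 1%N)) => [|u /andP[_ ->] //].
    by rewrite -big_nat sum_nat_const_nat subn0 muln1.
  by rewrite big_nat big1 // => u /andP[du _]; rewrite ltnNge du.
have scaled (F G : nat -> nat) : (forall u, (start <= u)%N -> (u < n)%N -> n * F u <= k * G u)%N ->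
    (n * (\sum_(start <= u < n) F u) <= k * (\sum_(start <= u < n) G u))%N.
  move=> FG; rewrite !big_distrr /= big_nat [leqRHS]big_nat.
  by apply: leq_sum => u /andP[su un]; exact: FG.
rewrite -(leq_pmul2l n0); apply: leq_trans (sum_delay zT); rewrite Tk.
apply: (@leq_trans (n * (\sum_pi (start <= delay pi T)
    + \sum_(start <= u < n) \sum_pi e pi u))%N).
  by rewrite leq_mul2l exchange_big -big_split leq_sum ?orbT.
rewrite [X in (_ <= _ * X)%N](eq_bigr _ (fun pi _ => delayE pi)).
rewrite [X in (_ <= _ * X)%N]exchange_big.
rewrite [X in (_ <= _ * X)%N](big_cat_nat (n := start)) //= 2!mulnDr leq_add //.
  (* If [T] is delayed to [start], all of the first [start] units count, and [n <= start * k]. *)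
  apply: (@leq_trans (start * k * \sum_pi (start <= delay pi T))%N).
    by rewrite leq_mul2r -start_le leqnn orbT.
  rewrite [(start * k)%N]mulnC -mulnA leq_mul2l; apply/orP; right.
  rewrite -[X in (X * _)%N]subn0 -sum_nat_const_nat.
  rewrite big_nat [leqRHS]big_nat; apply: leq_sum => u /andP[_ us].
  apply: leq_sum => pi _; have [ud|du] := ltnP u (delay pi T); first exact: leq_b1.
  by rewrite [(start <= _)%N]leqNgt (leq_ltn_trans du us).
apply: scaled => u su un.
(* The bound [n <= u.+1 * k] brings in the factor [u.+1] that [sum_record] needs. *)
apply: (@leq_trans (u.+1 * k * \sum_pi e pi u)%N).
  by rewrite leq_mul2r -start_le (leqW su) orbT.
rewrite [(u.+1 * k)%N]mulnC -mulnA leq_mul2l; apply/orP; right.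
exact: (sum_record T (Ordinal un)).
Qed.

(** Downward induction from [j = k], where the excess is at most Z_k: E[N_j] <= j/(j+1) E[N_{j+1}]
    <= j/(j+1) (j+1)/k = j/k. *)
Lemma sum_excess_chain (T : nat -> {set 'I_n}) :
  (forall j, (j <= k)%N -> #|T j| = j /\ is_top (T j)) ->
  (forall j, (j < k)%N -> exists2 z, z \notin T j & T j.+1 = z |: T j) ->
  forall j, (0 < j)%N -> (j <= k)%N ->
  (k * (\sum_pi excess pi (T j)) <= j * n`!)%N.
Proof.
move=> Tc TS.
have excess_k : (\sum_pi excess pi (T k) <= n`!)%N.
  have [Tk _] := Tc k (leqnn k); apply: leq_trans (sum_taken_before Tk).
  by apply: leq_sum => pi _; exact: leq_subr.
suff H i j : (i + j = k)%N -> (0 < j)%N -> (k * (\sum_pi excess pi (T j)) <= j * n`!)%N.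
  by move=> j j0 jk; apply: (H (k - j)%N) => //; exact: subnK.
elim: i j => [|i IH] j; first by rewrite add0n => -> _; rewrite leq_mul2l excess_k orbT.
rewrite addSnnS => ijk j0; have jk : (j < k)%N by lia.
have [z zT TE] := TS j jk; have [Tj topj] := Tc j (ltnW jk).
have [_ topj1] := Tc j.+1 jk.
have T0 : T j != set0 by rewrite -card_gt0 Tj.
have := IH j.+1 ijk isT; have := sum_excess_setU1 T0 topj _ zT.
rewrite -TE Tj => /(_ topj1 jk).
set A := (\sum_pi excess pi (T j))%N; set B := (\sum_pi excess pi (T j.+1))%N.
move=> h1 h2; rewrite -(leq_pmul2l (ltn0Sn j)).
have h3 : (k * (j.+1 * A) <= k * (j * B))%N by rewrite leq_mul2l h1 orbT.
have h4 : (j * (k * B) <= j * (j.+1 * n`!))%N by rewrite leq_mul2l h2 orbT.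
by move: h3 h4; lia.
Qed.
End Counting.

(** * Abel summation over value layers *)

Section Layers.
Variable R : realFieldType.
Implicit Types (g : nat -> R).

(** The thresholds at most [x] form a final segment of the nonincreasing [g], and their drops
    telescope to the largest of them. *)
Lemma layer_sum_le g k (x : R) : (forall i, g i.+1 <= g i) -> g k = 0 -> 0 <= x ->
  \sum_(i < k) (g i - g i.+1) * (g i <= x)%R%:R <= x.
Proof.
move=> gS gk x0; elim: k g gS gk => [|k IH] g gS gk; first by rewrite big_ord0.
have [gx|gx] := boolP (g 0%N <= x); last first.
  by rewrite big_ord_recl (negbTE gx) mulr0 add0r; exact: (IH (g \o succn) (fun i => gS i.+1) gk).
have telescope : \sum_(i < k.+1) (g i - g i.+1) = g 0%N.
  rewrite -(big_mkord xpredT (fun i => g i - g i.+1)).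
  rewrite (telescope_sumr_eq (fun i => - g i)) ?gk ?oppr0 ?opprK ?add0r // => i _.
  by rewrite opprK addrC.
apply: le_trans gx; rewrite -telescope; apply: ler_sum => i _.
by case: (_ <= x); rewrite ?mulr1 // mulr0 subr_ge0.
Qed.

Lemma layer_sum_eq g k :
  \sum_(i < k) (g i - g i.+1) * i.+1%:R = \sum_(i < k) g i - k%:R * g k.
Proof.
elim: k => [|k IH]; first by rewrite !big_ord0 mul0r subr0.
by rewrite !big_ord_recr /= IH -natr1; ring.
Qed.
End Layers.

(** * A fixed ranking of the awards *)

Section Ranking.
Variables (R : realFieldType) (n : nat) (v : 'I_n -> R).

Definition ranking : seq 'I_n := sort (fun a b => v b <= v a) (enum 'I_n).

(** A prefix of a ranking rather than a threshold set, so that ties in value still leave exactly [j]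
    elements for [j <= n]. *)
Definition top_set j : {set 'I_n} := [set a in take j ranking].

Lemma size_ranking : size ranking = n.
Proof. by rewrite size_sort size_enum_ord. Qed.

Lemma ranking_uniq : uniq ranking.
Proof. by rewrite sort_uniq enum_uniq. Qed.

Lemma mem_ranking a : a \in ranking.
Proof. by rewrite mem_sort mem_enum. Qed.

Lemma sorted_desc_ranking : sorted_desc v = [seq v a | a <- ranking].
Proof. exact: sort_map. Qed.

Lemma ranking_sorted z i j : (i <= j)%N -> (j < n)%N ->
  v (nth z ranking j) <= v (nth z ranking i).
Proof.
move=> ij jn; pose r := fun a b => v b <= v a.
have r_trans : transitive r by move=> b a c h1 h2; exact: le_trans h2 h1.
have r_refl : reflexive r by move=> a; exact: lexx.
have r_sorted : sorted r ranking by apply: sort_sorted => a b; exact: le_total.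
apply: (sorted_leq_nth r_trans r_refl z r_sorted) => //; rewrite inE size_ranking //.
exact: leq_ltn_trans jn.
Qed.

Lemma card_top_set j : (j <= n)%N -> #|top_set j| = j.
Proof.
move=> jn; rewrite cardsE (card_uniqP _) ?take_uniq ?ranking_uniq //.
by rewrite size_takel // size_ranking.
Qed.

Lemma mem_top_set j a : (a \in top_set j) = (index a ranking < j)%N.
Proof. by rewrite inE in_take // mem_ranking. Qed.

Lemma nth_ranking_index a : nth a ranking (index a ranking) = a.
Proof. by rewrite nth_index // mem_ranking. Qed.

Lemma index_ranking a : (index a ranking < n)%N.
Proof. by rewrite -[leqRHS]size_ranking index_mem mem_ranking. Qed.

Lemma top_setP j : is_top v (top_set j).
Proof.
move=> a b; rewrite !mem_top_set -leqNgt => aj jb.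
rewrite -(nth_ranking_index b) -(nth_ranking_index a).
rewrite (set_nth_default a) ?size_ranking ?index_ranking //.
by apply: ranking_sorted (index_ranking _); exact: ltnW (leq_trans aj jb).
Qed.

Lemma top_setS j : (j < n)%N ->
  exists2 z, z \notin top_set j & top_set j.+1 = z |: top_set j.
Proof.
move=> jn; pose z := nth (Ordinal jn) ranking j; exists z.
  by rewrite mem_top_set index_uniq ?size_ranking ?ranking_uniq // ltnn.
apply/setP=> a; rewrite in_setU1 !inE (take_nth (Ordinal jn)) ?size_ranking //.
by rewrite mem_rcons inE.
Qed.

Lemma nth_sorted_desc z j : (j < n)%N -> nth 0 (sorted_desc v) j = v (nth z ranking j).
Proof. by move=> jn; rewrite sorted_desc_ranking (nth_map z) // size_ranking. Qed.

Lemma top_set_ge j a : (j < n)%N -> a \in top_set j.+1 ->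
  nth 0 (sorted_desc v) j <= v a.
Proof.
move=> jn; rewrite mem_top_set ltnS (nth_sorted_desc a jn) => aj.
by rewrite -{2}(nth_ranking_index a) ranking_sorted // index_ranking.
Qed.
End Ranking.

(** * Passage from counts to values *)

Lemma play_layers (R : realFieldType) (n k : nat) (v : 'I_n -> R) (g : nat -> R)
    (pi : 'S_n) :
  (0 < k)%N -> (k <= n)%N -> (forall a, 0 <= v a) ->
  (forall i, g i.+1 <= g i) -> g k = 0 ->
  (forall i a, (i < k)%N -> a \in top_set v i.+1 -> g i <= v a) ->
  \sum_(i < k) (g i - g i.+1) * (i.+1 - excess k v pi (top_set v i.+1))%N%:R
    <= play v pi (fun _ : 'I_k => sigma v pi) (n + k) 1 [set: 'I_k] set0.
Proof.
move=> k0 kn v0 gS gk gT.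
have a1 : assigned k v pi 1 = set0 by apply: assigned_start.
have := @play_assigned _ _ k v pi (n + k) 1 [set: 'I_k].
rewrite a1 cards0 cardsT card_ord subn0 big_set0 add0r add1n => -> //.
set C := assigned k v pi _.
(* Each final award is worth at least the layers below its value; exchanging the sums then counts
   the final awards that reach each [g i]. *)
apply: (@le_trans _ _ (\sum_(a in C) \sum_(i < k) (g i - g i.+1) * (g i <= v a)%R%:R)); last first.
  by apply: ler_sum => a _; exact: layer_sum_le.
rewrite exchange_big /=; apply: ler_sum => i _; rewrite -mulr_sumr.
apply: ler_wpM2l; first by rewrite subr_ge0.
have ik : (i.+1 <= n)%N := leq_trans (ltn_ord i) kn.
have ci := card_top_set v ik.
have Ti0 : top_set v i.+1 != set0 by rewrite -card_gt0 ci.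
have := @final_above _ _ _ v k0 kn pi _ (g i) Ti0; rewrite ci => h.
rewrite -natr_sum ler_nat; apply: leq_trans (h (ltn_ord i) _) _; first by move=> a; exact: gT.
rewrite -sum1_card -/C [leqRHS]big_mkcond [leqLHS]big_mkcond /=.
by apply: leq_sum => a _; rewrite !inE; case: (a \in C) => //=; case: (_ <= _).
Qed.

Theorem theorem2 (R : realFieldType) (n k : nat) (hk : (0 < k)%N) (hkn : (k <= n)%N)
  (v : 'I_n -> R) (hv : forall a, 0 <= v a) :
  (k.-1)%:R / k%:R * top_sum v k
    <= expected_total v (fun pi => fun _ : 'I_k => sigma v pi).
Proof.
(* Cutting off to [0] at [k] lets the layers telescope without remainder; [g] stays nonincreasing
   because awards are nonnegative. *)
pose g i := if (i < k)%N then nth 0 (sorted_desc v) i else 0.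
have gE i : (i < k)%N -> g i = nth 0 (sorted_desc v) i by rewrite /g => ->.
have gk : g k = 0 by rewrite /g ltnn.
have n0 : (0 < n)%N := leq_trans hk hkn.
have gS i : g i.+1 <= g i.
  rewrite /g; case: ltnP => i1k.
    have ik : (i < k)%N := ltnW i1k; have i1n := leq_trans i1k hkn.
    by rewrite ik !(nth_sorted_desc v (Ordinal n0)) ?ranking_sorted // ltnW.
  case: ifP => // ik.
  by rewrite (nth_sorted_desc v (Ordinal n0)) // (leq_trans ik).
have gT i a : (i < k)%N -> a \in top_set v i.+1 -> g i <= v a.
  by move=> ik; rewrite gE // => /top_set_ge -> //; exact: leq_trans ik hkn.
have topE : top_sum v k = \sum_(i < k) (g i - g i.+1) * i.+1%:R.
  by rewrite layer_sum_eq gk mulr0 subr0; apply: eq_bigr => i _; rewrite gE.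
(* This is E[j - N_j] >= j - j/k with denominators cleared. *)
have kept j : (0 < j)%N -> (j <= k)%N ->
    (k.-1 * (j * n`!) <= k * \sum_(pi : 'S_n) (j - excess k v pi (top_set v j)))%N.
  move=> j0 jk.
  have H : (j * n`! <= \sum_(pi : 'S_n) (j - excess k v pi (top_set v j))
       + \sum_(pi : 'S_n) excess k v pi (top_set v j))%N.
    rewrite -big_split -card_Sn mulnC -sum_nat_const /=.
    by apply: leq_sum => pi _; rewrite addnC -leq_subLR.
  have := @sum_excess_chain _ n k v hk hkn (top_set v) _ _ j j0 jk.
  move=> /(_ (fun i ik => conj (card_top_set v (leq_trans ik hkn)) (@top_setP _ _ v i))).
  move=> /(_ (fun i ik => top_setS v (leq_trans ik hkn))).
  move=> chain; rewrite -subn1 mulnBl mul1n leq_subLR addnC.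
  move: H; rewrite -(leq_pmul2l hk) mulnDr => /leq_trans -> //.
  by rewrite leq_add2l.
rewrite /expected_total mulrAC ler_pdivrMr ?ltr0n //.
rewrite -[leRHS]mulrA ler_pdivlMl ?ltr0n ?fact_gt0 //.
apply: (@le_trans _ _ ((\sum_(pi : 'S_n) \sum_(i < k)
    (g i - g i.+1) * (i.+1 - excess k v pi (top_set v i.+1))%N%:R) * k%:R)); last first.
  by apply: ler_wpM2r; [exact: ler0n | apply: ler_sum => pi _; exact: play_layers].
rewrite topE exchange_big /= mulr_suml !mulr_sumr; apply: ler_sum => i _.
rewrite -mulr_sumr -mulrA !(mulrCA _ (g i - g i.+1)).
apply: ler_wpM2l; first by rewrite subr_ge0.
rewrite -natr_sum -!natrM ler_nat mulnCA [leqRHS]mulnC (mulnC n`!).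
exact: kept.
Qed.
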